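(* Let $\alpha\in\mathbb{R}$ and $\beta\ge 0$, and let $$f_{\alpha,\beta,-1}(x)=\biggl[\frac{e^x\,\Gamma(x+\beta)}{x^{x+\beta-\alpha}}\biggr]^{-1},\qquad x\in(0,\infty).$$ If the function $f_{\alpha,\beta,-1}$ is logarithmically completely monotonic on $(0,\infty)$, then either $\beta>0$ and $\alpha\ge\max\bigl\{\beta,\tfrac12\bigr\}$, or $\beta=0$ and $\alpha\ge 1$.
   Context: $\Gamma$ denotes the classical Euler gamma function, $\Gamma(x)=\int_0^\infty t^{x-1}e^{-t}\,dt$ for $x>0$. A positive function $f$ is said to be logarithmically completely monotonic on an interval $I$ if $f$ has derivatives of all orders on $I$ and $(-1)^n[\ln f(x)]^{(n)}\ge 0$ for all $x\in I$ and all $n\in\mathbb{N}=\{1,2,3,\dots\}$. *)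

(* Defs.v *)
(* Stdlib reals with Coquelicot. *)
From Stdlib Require Export Reals.
From Coquelicot Require Export Coquelicot.
Open Scope R_scope.

(* Improper Riemann integral over (0, +oo), meaningful for x > 0. It is improper
   at 0 as well as at +oo, since the integrand is unbounded near 0 when x < 1. *)
Definition Gamma (x : R) : R :=
  RInt_gen (fun t : R => Rpower t (x - 1) * exp (- t))
    (at_right 0) (Rbar_locally p_infty).

(* The interval is the open interval (a, b) with extended real endpoints, so that
   the two-sided derivatives at its points depend only on f restricted to (a, b). *)
Definition log_completely_monotonic (a b : Rbar) (f : R -> R) : Prop :=
  (forall x : R, Rbar_lt a x -> Rbar_lt x b -> 0 < f x) /\
  (forall (n : nat) (x : R), Rbar_lt a x -> Rbar_lt x b -> ex_derive_n f n x) /\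
  (forall (n : nat) (x : R), (1 <= n)%nat -> Rbar_lt a x -> Rbar_lt x b ->
     0 <= (-1) ^ n * Derive_n (fun y : R => ln (f y)) n x).

(* Only the values at x > 0 matter: there Rpower is the usual real power, and the
   argument of Gamma is positive when beta >= 0. *)
Definition f_alpha_beta_m1 (alpha beta x : R) : R :=
  / (exp x * Gamma (x + beta) / Rpower x (x + beta - alpha)).

(* Main.v *)
(** Write F = ln f. The case n = 1 of complete monotonicity says that F is
    nonincreasing. Comparing F(x) with F(1) as x -> 0 and using
    Gamma(s) >= exp(-2)/s gives (beta - alpha) ln x >= C when beta > 0 and
    (1 - alpha) ln x >= C when beta = 0, hence alpha >= beta, respectively
    alpha >= 1. Comparing F(n - beta) with F(1) for large integers n and using
    ln Gamma(n) <= (n - 1/2) ln n - n + 1 gives (1/2 - alpha) ln n <= C, hence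
    alpha >= 1/2. *)
Require Import Defs.
From Stdlib Require Import Reals Lra Lia Factorial.
From Coquelicot Require Import Coquelicot.
Open Scope R_scope.

(** * Integrals against increments of primitives, and improper integrals *)

Lemma is_derive_continuity_pt (f : R -> R) (x l : R) :
  is_derive f x l -> continuity_pt f x.
Proof.
  intros h. apply continuity_pt_filterlim.
  apply (ex_derive_continuous (V := R_NormedModule)). now exists l.
Qed.

Lemma RInt_le_increment (f G dG : R -> R) (a b : R) :
  a <= b -> ex_RInt f a b ->
  (forall t, a <= t <= b -> is_derive G t (dG t)) ->
  (forall t, a <= t <= b -> continuous dG t) ->
  (forall t, a <= t <= b -> f t <= dG t) ->
  RInt f a b <= G b - G a.
Proof.
  intros hab hf hG hc hle.
  assert (hI : is_RInt dG a b (G b - G a)).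
  { apply (is_RInt_derive G dG); rewrite Rmin_left, Rmax_right by lra; auto. }
  rewrite <- (is_RInt_unique _ _ _ _ hI).
  apply RInt_le; auto.
  - eexists; apply hI.
  - intros x hx; apply hle; lra.
Qed.

Lemma increment_le_RInt (f G dG : R -> R) (a b : R) :
  a <= b -> ex_RInt f a b ->
  (forall t, a <= t <= b -> is_derive G t (dG t)) ->
  (forall t, a <= t <= b -> continuous dG t) ->
  (forall t, a <= t <= b -> dG t <= f t) ->
  G b - G a <= RInt f a b.
Proof.
  intros hab hf hG hc hle.
  assert (hI : is_RInt dG a b (G b - G a)).
  { apply (is_RInt_derive G dG); rewrite Rmin_left, Rmax_right by lra; auto. }
  rewrite <- (is_RInt_unique _ _ _ _ hI).
  apply RInt_le; auto.
  - eexists; apply hI.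
  - intros x hx; apply hle; lra.
Qed.

(** For a nonnegative integrand, integrals over compact subintervals grow with the interval, so
    their supremum is their limit. This proves convergence, without which the value of [RInt_gen]
    says nothing. *)
Lemma RInt_gen_nonneg_bounded (f : R -> R) (M : R) :
  (forall t, 0 < t -> continuous f t) ->
  (forall t, 0 < t -> 0 <= f t) ->
  (forall a b, 0 < a -> a <= b -> RInt f a b <= M) ->
  RInt_gen f (at_right 0) (Rbar_locally p_infty) <= M /\
  (forall a b, 0 < a -> a <= b ->
     RInt f a b <= RInt_gen f (at_right 0) (Rbar_locally p_infty)).
Proof.
  intros hc hpos hM.
  assert (hex : forall a b, 0 < a -> a <= b -> ex_RInt f a b).
  { intros a b ha hab. apply (@ex_RInt_continuous R_CompleteNormedModule).
    rewrite Rmin_left, Rmax_right by lra. intros; apply hc; lra. }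
  pose (E := fun y => exists a b, 0 < a /\ a <= b /\ y = RInt f a b).
  destruct (completeness E) as [l [hub hlub]].
  - exists M. intros y (a & b & ha & hab & ->). auto.
  - exists (RInt f 1 1), 1, 1. repeat split; lra.
  - assert (hl : is_RInt_gen f (at_right 0) (Rbar_locally p_infty) l).
    { intros P [eps hP].
      assert (hab : exists a b, 0 < a /\ a <= b /\ l - eps < RInt f a b).
      { apply Classical_Prop.NNPP; intros hn.
        assert (l <= l - eps).
        { apply hlub. intros y (a & b & ha & hab & ->).
          apply Rnot_lt_le; intros hlt. apply hn. exists a, b. auto. }
        pose proof (cond_pos eps). lra. }
      destruct hab as (a & b & ha & hab & hlt).
      (* Any interval containing [[a, b]] has integral between [l - eps] and [l]. *)
      apply Filter_prod with (fun x => 0 < x < a) (fun y => b < y).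
      - exists (mkposreal a ha). intros x hx hx0. split; auto.
        unfold ball in hx; simpl in hx.
        unfold AbsRing_ball, abs, minus, plus, opp in hx; simpl in hx.
        apply Rabs_lt_between in hx. lra.
      - exists b. auto.
      - intros x y hx hy. simpl. exists (RInt f x y). split.
        + apply (RInt_correct (V := R_CompleteNormedModule)), hex; lra.
        + apply hP.
          assert (h1 : RInt f x y <= l) by (apply hub; exists x, y; repeat split; lra).
          assert (h2 : RInt f a b <= RInt f x y).
          { pose proof (RInt_Chasles f x a y ltac:(apply hex; lra) ltac:(apply hex; lra)) as e1.
            pose proof (RInt_Chasles f a b y ltac:(apply hex; lra) ltac:(apply hex; lra)) as e2.
            unfold plus in e1, e2; simpl in e1, e2.
            assert (0 <= RInt f x a)
              by (apply RInt_ge_0; [lra | apply hex; lra | intros; apply hpos; lra]).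
            assert (0 <= RInt f b y)
              by (apply RInt_ge_0; [lra | apply hex; lra | intros; apply hpos; lra]).
            lra. }
          unfold ball; simpl.
          unfold AbsRing_ball, abs, minus, plus, opp; simpl.
          apply Rabs_lt_between. pose proof (cond_pos eps). lra. }
    rewrite (is_RInt_gen_unique _ _ hl). split.
    + apply hlub. intros y (a & b & ha & hab & ->). auto.
    + intros a b ha hab. apply hub. exists a, b. auto.
Qed.

(** * Tails of the Gamma integral at integer exponents *)

(* [exp t] times the integral of [u ^ n * exp (- u)] over [(t, +oo)]. *)
Fixpoint Gamma_tail_poly (n : nat) (t : R) : R :=
  match n with
  | O => 1
  | S m => t ^ S m + INR (S m) * Gamma_tail_poly m t
  end.

(** The recursion of [Gamma_tail_poly] is integration by parts: differentiating
    [exp (- u) * u ^ S n] leaves a term in [u ^ n] that the induction hypothesis cancels. *)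
Lemma is_derive_Gamma_tail (n : nat) (t : R) :
  is_derive (fun u => exp (- u) * Gamma_tail_poly n u) t (- (t ^ n * exp (- t))).
Proof.
  revert t; induction n as [|n IH]; intros t.
  - simpl. auto_derive; auto. ring.
  - apply is_derive_ext with
      (fun u => exp (- u) * u ^ S n + INR (S n) * (exp (- u) * Gamma_tail_poly n u)).
    + intros u.
      change (exp (- u) * u ^ S n + INR (S n) * (exp (- u) * Gamma_tail_poly n u)
        = exp (- u) * (u ^ S n + INR (S n) * Gamma_tail_poly n u) :> R).
      ring.
    + replace (- (t ^ S n * exp (- t))) with
        ((- exp (- t) * t ^ S n + exp (- t) * (INR (S n) * t ^ n))
         + INR (S n) * (- (t ^ n * exp (- t)))) by ring.
      apply (is_derive_plus (K := R_AbsRing) (V := R_NormedModule)).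
      * auto_derive; auto. rewrite S_INR. simpl.
        destruct n; simpl; ring.
      * apply (is_derive_scal (fun u => exp (- u) * Gamma_tail_poly n u)), IH.
Qed.

Lemma Gamma_tail_poly_0 (n : nat) : Gamma_tail_poly n 0 = INR (fact n).
Proof.
  induction n as [|n IH]; [reflexivity|].
  change (Gamma_tail_poly (S n) 0) with (0 ^ S n + INR (S n) * Gamma_tail_poly n 0).
  rewrite IH, pow_ne_zero, fact_simpl, mult_INR by lia. ring.
Qed.

Lemma pow_le_Gamma_tail_poly (n : nat) (t : R) : 0 <= t -> t ^ n <= Gamma_tail_poly n t.
Proof.
  intros ht. destruct n as [|n]; [simpl; lra|].
  assert (h : forall m, 0 <= Gamma_tail_poly m t).
  { induction m as [|m IH]; [simpl; lra|].
    apply Rplus_le_le_0_compat; [now apply pow_le|].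
    apply Rmult_le_pos; auto. apply pos_INR. }
  change (Gamma_tail_poly (S n) t) with (t ^ S n + INR (S n) * Gamma_tail_poly n t).
  pose proof (Rmult_le_pos _ _ (pos_INR (S n)) (h n)). lra.
Qed.

(** The tail has derivative [- (u ^ n * exp (- u))], so it decreases from its value [n!] at 0. *)
Lemma Gamma_tail_le_fact (n : nat) (t : R) :
  0 <= t -> exp (- t) * Gamma_tail_poly n t <= INR (fact n).
Proof.
  intros ht.
  destruct (MVT_gen (fun u => exp (- u) * Gamma_tail_poly n u) 0 t
    (fun u => - (u ^ n * exp (- u)))) as (c & hc & e).
  - intros x _. apply is_derive_Gamma_tail.
  - intros x _. eapply is_derive_continuity_pt, is_derive_Gamma_tail.
  - rewrite Rmin_left, Rmax_right in hc by lra.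
    rewrite Ropp_0, exp_0, Gamma_tail_poly_0 in e.
    pose proof (pow_le c n ltac:(lra)). pose proof (exp_pos (- c)).
    assert (0 <= c ^ n * exp (- c) * t) by (repeat apply Rmult_le_pos; lra).
    lra.
Qed.

Lemma Gamma_tail_bounds (n : nat) (t : R) :
  0 <= t -> 0 <= t ^ n * exp (- t) <= exp (- t) * Gamma_tail_poly n t.
Proof.
  intros ht. pose proof (exp_pos (- t)). pose proof (pow_le t n ht).
  split; [apply Rmult_le_pos; lra|].
  rewrite Rmult_comm. apply Rmult_le_compat_l; [lra|].
  now apply pow_le_Gamma_tail_poly.
Qed.

(** * Convergence of the Gamma integral *)

Lemma is_derive_Rpower_l (s t : R) :
  0 < t -> is_derive (fun u => Rpower u s) t (s * Rpower t (s - 1)).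
Proof. intros ht. now apply is_derive_Reals, derivable_pt_lim_power. Qed.

Lemma continuous_Rpower_l (s t : R) : 0 < t -> continuous (fun u => Rpower u s) t.
Proof.
  intros ht. apply (ex_derive_continuous (V := R_NormedModule)).
  eexists; now apply is_derive_Rpower_l.
Qed.

Lemma continuous_exp_opp (t : R) : continuous (fun u => exp (- u)) t.
Proof. apply (ex_derive_continuous (V := R_NormedModule)). auto_derive; auto. Qed.

Lemma continuous_Gamma_integrand (s t : R) :
  0 < t -> continuous (fun u => Rpower u (s - 1) * exp (- u)) t.
Proof.
  intros ht. apply (continuous_mult (K := R_AbsRing)).
  - now apply continuous_Rpower_l.
  - apply continuous_exp_opp.
Qed.

Lemma continuous_pow_exp_opp (n : nat) (t : R) :
  continuous (fun u => u ^ n * exp (- u)) t.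
Proof. apply (ex_derive_continuous (V := R_NormedModule)). auto_derive; auto. Qed.

Lemma ex_RInt_Gamma_integrand (s a b : R) :
  0 < a -> a <= b -> ex_RInt (fun t => Rpower t (s - 1) * exp (- t)) a b.
Proof.
  intros ha hab. apply (@ex_RInt_continuous R_CompleteNormedModule).
  rewrite Rmin_left, Rmax_right by lra.
  intros; apply continuous_Gamma_integrand; lra.
Qed.

Lemma Gamma_integrand_pos (s t : R) : 0 < Rpower t (s - 1) * exp (- t).
Proof. apply Rmult_lt_0_compat; apply exp_pos. Qed.

Lemma Rpower_le_1_plus_pow (s t : R) (n : nat) :
  0 < s -> s <= INR n -> 0 < t -> Rpower t s <= 1 + t ^ n.
Proof.
  intros hs hn ht. pose proof (pow_lt t n ht).
  destruct (Rle_dec t 1) as [h|h].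
  - assert (Rpower t s <= Rpower 1 s) by (apply Rle_Rpower_l; lra).
    unfold Rpower at 2 in H0. rewrite ln_1, Rmult_0_r, exp_0 in H0. lra.
  - assert (Rpower t s <= Rpower t (INR n)) by (apply Rle_Rpower; lra).
    rewrite Rpower_pow in H0; lra.
Qed.

(* Integrating by parts replaces the exponent [s - 1] by [s > 0], for which the
   integrand is at most [(1 + t ^ n) * exp (- t)]. *)
Lemma Gamma_integral_bounded (s : R) :
  0 < s -> exists M, forall a b, 0 < a -> a <= b ->
    RInt (fun t => Rpower t (s - 1) * exp (- t)) a b <= M.
Proof.
  intros hs. destruct (INR_unbounded s) as [n hn].
  (* [- W] is a primitive of [(t ^ n + 1) * exp (- t)], which dominates [Rpower t s * exp (- t)].
     Hence the derivative [dG] of [G] is at least the Gamma integrand. *)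
  pose (W := fun t => exp (- t) * Gamma_tail_poly n t + exp (- t) * Gamma_tail_poly 0 t).
  pose (G := fun t => / s * (Rpower t s * exp (- t) - W t)).
  pose (dG := fun t => / s * ((s * Rpower t (s - 1) * exp (- t) - Rpower t s * exp (- t))
                     + (t ^ n * exp (- t) + t ^ 0 * exp (- t)))).
  exists (/ s * (2 * (INR (fact n) + 1))). intros a b ha hab.
  apply Rle_trans with (G b - G a).
  - apply RInt_le_increment with dG; auto.
    + now apply ex_RInt_Gamma_integrand.
    + intros t ht. apply (is_derive_scal (fun t => Rpower t s * exp (- t) - W t)).
      replace (s * Rpower t (s - 1) * exp (- t) - Rpower t s * exp (- t)
               + (t ^ n * exp (- t) + t ^ 0 * exp (- t))) with
        ((s * Rpower t (s - 1) * exp (- t) + Rpower t s * - exp (- t))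
         - (- (t ^ n * exp (- t)) + - (t ^ 0 * exp (- t)))) by ring.
      apply (is_derive_minus (K := R_AbsRing) (V := R_NormedModule)).
      * apply (is_derive_mult (K := R_AbsRing) (fun t => Rpower t s) (fun t => exp (- t))).
        -- apply is_derive_Rpower_l; lra.
        -- auto_derive; auto; ring.
        -- intros; apply Rmult_comm.
      * apply (is_derive_plus (K := R_AbsRing) (V := R_NormedModule));
          apply is_derive_Gamma_tail.
    + intros t ht. unfold dG.
      apply (continuous_mult (K := R_AbsRing)); [apply continuous_const|].
      apply (continuous_plus (V := R_NormedModule)).
      * apply (continuous_minus (V := R_NormedModule));
          apply (continuous_mult (K := R_AbsRing)); try apply continuous_exp_opp.
        -- apply (continuous_mult (K := R_AbsRing)); [apply continuous_const|].
           apply continuous_Rpower_l; lra.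
        -- apply continuous_Rpower_l; lra.
      * apply (continuous_plus (V := R_NormedModule)); apply continuous_pow_exp_opp.
    + intros t ht. unfold dG.
      pose proof (Rpower_le_1_plus_pow s t n hs ltac:(lra) ltac:(lra)) as h.
      pose proof (exp_pos (- t)) as he.
      apply Rmult_le_reg_l with s; auto.
      rewrite <- (Rmult_assoc s (/ s)), Rinv_r, Rmult_1_l by lra.
      simpl. nra.
  (* In [G b - G a], the Rpower term at [b] and [W a] are each at most [n! + 1]; the other two terms
     enter with a minus sign and are nonnegative. *)
  - assert (hW : forall t, 0 < t -> 0 <= W t <= INR (fact n) + 1).
    { intros t ht. unfold W.
      pose proof (Gamma_tail_bounds n t ltac:(lra)).
      pose proof (Gamma_tail_bounds 0 t ltac:(lra)).
      pose proof (Gamma_tail_le_fact n t ltac:(lra)).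
      pose proof (Gamma_tail_le_fact 0 t ltac:(lra)) as h0.
      change (INR (fact 0)) with 1 in h0. lra. }
    assert (hR : forall t, 0 < t -> 0 <= Rpower t s * exp (- t) <= W t).
    { intros t ht.
      pose proof (Rpower_le_1_plus_pow s t n hs ltac:(lra) ltac:(lra)) as h.
      pose proof (exp_pos (- t)) as he. pose proof (exp_pos (s * ln t)) as hp.
      fold (Rpower t s) in hp.
      split; [apply Rmult_le_pos; lra|]. unfold W.
      pose proof (Gamma_tail_bounds n t ltac:(lra)).
      simpl. nra. }
    unfold G. rewrite <- Rmult_minus_distr_l.
    apply Rmult_le_compat_l; [left; now apply Rinv_0_lt_compat|].
    pose proof (hW a ltac:(lra)). pose proof (hW b ltac:(lra)).
    pose proof (hR a ltac:(lra)). pose proof (hR b ltac:(lra)). lra.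
Qed.

(** * Bounds for Gamma *)

Lemma RInt_le_Gamma (s a b : R) :
  0 < s -> 0 < a -> a <= b ->
  RInt (fun t => Rpower t (s - 1) * exp (- t)) a b <= Gamma s.
Proof.
  intros hs. destruct (Gamma_integral_bounded s hs) as [M hM].
  apply (RInt_gen_nonneg_bounded (fun t => Rpower t (s - 1) * exp (- t)) M); auto.
  - intros; now apply continuous_Gamma_integrand.
  - intros; left; apply Gamma_integrand_pos.
Qed.

(** The explicit primitive bounds each truncated integral by the tail at [a], itself at most
    [n!]. *)
Lemma Gamma_S_le_fact (n : nat) : Gamma (INR n + 1) <= INR (fact n).
Proof.
  apply (RInt_gen_nonneg_bounded
    (fun t => Rpower t (INR n + 1 - 1) * exp (- t)) (INR (fact n))).
  - intros; now apply continuous_Gamma_integrand.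
  - intros; left; apply Gamma_integrand_pos.
  - intros a b ha hab.
    pose proof (Gamma_tail_le_fact n a ltac:(lra)).
    pose proof (Gamma_tail_bounds n b ltac:(lra)).
    apply Rle_trans with
      (- (exp (- b) * Gamma_tail_poly n b) - - (exp (- a) * Gamma_tail_poly n a));
      [|lra].
    apply (RInt_le_increment _ (fun t => - (exp (- t) * Gamma_tail_poly n t))
      (fun t => t ^ n * exp (- t))); auto.
    + now apply ex_RInt_Gamma_integrand.
    + intros t ht. rewrite <- (Ropp_involutive (t ^ n * exp (- t))).
      apply (is_derive_opp (K := R_AbsRing) (V := R_NormedModule)).
      apply is_derive_Gamma_tail.
    + intros; apply continuous_pow_exp_opp.
    + intros t ht. replace (INR n + 1 - 1) with (INR n) by ring.
      rewrite Rpower_pow; lra.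
Qed.

(* The integral over [(exp (- 1 / s), 1)] already suffices, as [t ^ s] runs from
   [exp (- 1)] to [1] there. *)
Lemma Gamma_lower_bound (s : R) : 0 < s -> exp (-2) / s <= Gamma s.
Proof.
  intros hs. pose (a := exp (- / s)).
  assert (ha : 0 < a) by apply exp_pos.
  pose proof (Rinv_0_lt_compat _ hs) as hsi.
  assert (ha1 : a <= 1).
  { rewrite <- exp_0. left; apply exp_increasing. lra. }
  apply Rle_trans with (2 := RInt_le_Gamma s a 1 hs ha ha1).
  pose (G := fun t => exp (-1) / s * Rpower t s).
  apply Rle_trans with (G 1 - G a).
  - unfold G, Rpower. rewrite ln_1, Rmult_0_r, exp_0. unfold a. rewrite ln_exp.
    replace (s * - / s) with (-1) by (field; lra).
    replace (-2) with (-1 + -1) by ring. rewrite exp_plus.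
    (* The increment of [G] is [exp (-1) * (1 - exp (-1)) / s], and this bound gives
       [1 - exp (-1) >= exp (-1)]. *)
    assert (h : exp (-1) <= / 2).
    { change (-1) with (- (1)). rewrite exp_Ropp. apply Rinv_le_contravar; [lra|].
      pose proof (exp_ineq1 1). lra. }
    unfold Rdiv. pose proof (exp_pos (-1)).
    pose proof (Rmult_lt_0_compat _ _ H hsi). nra.
  - apply increment_le_RInt with (fun t => exp (-1) / s * (s * Rpower t (s - 1))); auto.
    + now apply ex_RInt_Gamma_integrand.
    + intros t ht. apply (is_derive_scal (fun t => Rpower t s)).
      apply is_derive_Rpower_l; lra.
    + intros t ht.
      repeat (apply (continuous_mult (K := R_AbsRing)); [apply continuous_const|]).
      apply continuous_Rpower_l; lra.
    + intros t ht.
      replace (exp (-1) / s * (s * Rpower t (s - 1)))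
        with (Rpower t (s - 1) * exp (-1)) by (field; lra).
      apply Rmult_le_compat_l; [left; apply exp_pos|].
      destruct (Req_dec t 1) as [->|]; [apply Rle_refl|].
      left; apply exp_increasing; lra.
Qed.

Lemma Gamma_pos (s : R) : 0 < s -> 0 < Gamma s.
Proof.
  intros hs. apply Rlt_le_trans with (2 := Gamma_lower_bound s hs).
  apply Rdiv_lt_0_compat; auto. apply exp_pos.
Qed.

(** * A Stirling-type bound for the factorial *)

(** The difference of the two sides vanishes at 0 and has derivative
    [x ^ 2 / ((1 + x) * (2 + x) ^ 2)]. The left side is the first diagonal Padé approximant of the
    logarithm. *)
Lemma ln_1_plus_lower_bound (t : R) : 0 <= t -> 2 * t / (2 + t) <= ln (1 + t).
Proof.
  intros ht.
  assert (hd : forall x, 0 <= x -> is_derive (fun x => ln (1 + x) - 2 * x / (2 + x)) x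
     (x ^ 2 / ((1 + x) * (2 + x) ^ 2))).
  { intros x hx. auto_derive; [repeat split; lra | field; lra]. }
  destruct (MVT_gen (fun x => ln (1 + x) - 2 * x / (2 + x)) 0 t
    (fun x => x ^ 2 / ((1 + x) * (2 + x) ^ 2))) as (c & hc & e);
    rewrite Rmin_left, Rmax_right in * by lra.
  - intros x hx. apply hd; lra.
  - intros x hx. eapply is_derive_continuity_pt, hd; lra.
  - rewrite Rplus_0_r, ln_1 in e.
    assert (0 <= c ^ 2 / ((1 + c) * (2 + c) ^ 2)).
    { apply Rmult_le_pos; [apply pow2_ge_0|].
      left; apply Rinv_0_lt_compat. apply Rmult_lt_0_compat; [lra|].
      apply pow_lt; lra. }
    pose proof (Rmult_le_pos _ _ H ht). lra.
Qed.

(** With [u = n + 1], the induction step amounts to [(u + 1/2) * ln (1 + 1/u) >= 1], which is the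
    previous bound at [t = 1/u]. *)
Lemma ln_fact_le (n : nat) :
  ln (INR (fact n)) <= (INR n + 1 / 2) * ln (INR n + 1) - INR n.
Proof.
  induction n as [|n IH].
  - simpl. rewrite !Rplus_0_l, ln_1. lra.
  - rewrite fact_simpl, mult_INR, ln_mult, S_INR
      by (apply lt_0_INR; try apply lt_O_fact; lia).
    pose proof (pos_INR n) as hn. set (u := INR n + 1) in *.
    assert (hu : 1 <= u) by (unfold u; lra).
    pose proof (ln_1_plus_lower_bound (/ u)
      ltac:(left; apply Rinv_0_lt_compat; lra)) as h.
    replace (2 * / u / (2 + / u)) with (/ (u + 1 / 2)) in h by (field; lra).
    assert (e : ln (u + 1) = ln u + ln (1 + / u)).
    { rewrite <- ln_mult.
      - f_equal. field; lra.
      - lra.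
      - pose proof (Rinv_0_lt_compat u ltac:(lra)). lra. }
    rewrite e.
    assert (1 <= (u + 1 / 2) * ln (1 + / u)).
    { rewrite <- (Rinv_r (u + 1 / 2)) at 1 by lra.
      apply Rmult_le_compat_l; lra. }
    replace (INR n) with (u - 1) in * by (unfold u; ring). lra.
Qed.

(** * Monotonicity of [ln f] and its consequences at 0 and at infinity *)

Lemma log_completely_monotonic_nonincreasing (f : R -> R) (x y : R) :
  log_completely_monotonic 0 p_infty f -> 0 < x -> x <= y -> ln (f y) <= ln (f x).
Proof.
  intros (hpos & hder & hmon) hx hxy.
  assert (hd : forall z, 0 < z ->
    is_derive (fun z => ln (f z)) z (Derive (fun z => ln (f z)) z)).
  { intros z hz. apply Derive_correct.
    eexists. apply (is_derive_comp ln f).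
    - apply is_derive_ln. apply hpos; simpl; auto.
    (* [Derive] is total, so the sign condition alone does not give differentiability; it comes from
       that of [f]. *)
    - apply Derive_correct. apply (hder 1%nat z); simpl; auto. }
  destruct (MVT_gen (fun z => ln (f z)) x y (Derive (fun z => ln (f z))))
    as (c & hc & e); rewrite Rmin_left, Rmax_right in * by lra.
  - intros z hz. apply hd; lra.
  - intros z hz. eapply is_derive_continuity_pt, hd; lra.
  - pose proof (hmon 1%nat c (le_n 1) ltac:(simpl; lra) I) as h. simpl in h.
    change (Derive (fun x => ln (f x)) c) with (Derive (fun z => ln (f z)) c) in h.
    nra.
Qed.

Lemma ln_f_alpha_beta_m1 (alpha beta x : R) : 0 <= beta -> 0 < x ->
  ln (f_alpha_beta_m1 alpha beta x)
  = (x + beta - alpha) * ln x - x - ln (Gamma (x + beta)).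
Proof.
  intros hb hx. pose proof (Gamma_pos (x + beta) ltac:(lra)) as hG.
  pose proof (exp_pos x) as he.
  unfold f_alpha_beta_m1, Rpower.
  pose proof (exp_pos ((x + beta - alpha) * ln x)) as hp.
  rewrite ln_Rinv, ln_div, ln_mult, !ln_exp; auto; try ring.
  - now apply Rmult_lt_0_compat.
  - apply Rdiv_lt_0_compat; auto. now apply Rmult_lt_0_compat.
Qed.

Lemma nonpos_of_mult_ln_bounded_below (d C : R) :
  (forall x, 0 < x < 1 -> C <= d * ln x) -> d <= 0.
Proof.
  intros h. apply Rnot_lt_le; intros hd.
  (* At [x = exp (- K)] the product [d * ln x] equals [- d - Rabs C], which is below [C]. *)
  pose (K := 1 + Rabs C / d).
  assert (0 <= Rabs C / d).
  { apply Rmult_le_pos; [apply Rabs_pos|]. left; now apply Rinv_0_lt_compat. }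
  assert (hK : 1 <= K) by (unfold K; lra).
  specialize (h (exp (- K))). rewrite ln_exp in h.
  assert (C <= d * - K).
  { apply h. split; [apply exp_pos|]. rewrite <- exp_0. apply exp_increasing; lra. }
  assert (e : d * - K = - d - Rabs C) by (unfold K; field; lra).
  pose proof (Rle_abs (- C)) as h2. rewrite Rabs_Ropp in h2. lra.
Qed.

(** The term [ln (x + beta)] stays in the bound because it is bounded above when [beta > 0] but
    equals [ln x] when [beta = 0]. The 2 in the constant comes from [exp (-2)]; [x * ln x] and [- x]
    are nonpositive and dropped. *)
Lemma near_zero_bound (alpha beta : R) : 0 <= beta ->
  log_completely_monotonic 0 p_infty (f_alpha_beta_m1 alpha beta) ->
  exists C, forall x, 0 < x < 1 -> C <= (beta - alpha) * ln x + ln (x + beta).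
Proof.
  intros hb hf. exists (ln (f_alpha_beta_m1 alpha beta 1) - 2). intros x hx.
  pose proof (log_completely_monotonic_nonincreasing _ x 1 hf
    ltac:(lra) ltac:(lra)) as h.
  rewrite (ln_f_alpha_beta_m1 alpha beta x) in h by lra.
  pose proof (Gamma_lower_bound (x + beta) ltac:(lra)) as hG.
  apply ln_le in hG; [|apply Rdiv_lt_0_compat; [apply exp_pos | lra]].
  rewrite ln_div, ln_exp in hG; [|apply exp_pos | lra].
  assert (hl : ln x <= 0) by (rewrite <- ln_1; apply ln_le; lra).
  nra.
Qed.

Lemma near_infinity_bound (alpha beta : R) : 0 <= beta -> alpha < 1 / 2 ->
  log_completely_monotonic 0 p_infty (f_alpha_beta_m1 alpha beta) ->
  exists C, forall n, 2 * beta + 1 <= INR n -> (1 / 2 - alpha) * ln (INR n + 1) <= C.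
Proof.
  intros hb ha hf.
  (* The 1 comes from the factorial bound, the last summand from replacing [ln (n - beta)] by
     [ln n]. *)
  exists (ln (f_alpha_beta_m1 alpha beta 1) + 1 + 2 * beta * (1 + Rabs alpha)).
  intros m hm. pose proof (ln_fact_le m) as hfact.
  pose proof (Gamma_S_le_fact m) as hG.
  set (n := INR m + 1) in *. assert (hn : 2 * beta + 2 <= n) by (unfold n; lra).
  (* At [n - beta] the argument of Gamma is the integer [n]. *)
  pose proof (log_completely_monotonic_nonincreasing _ 1 (n - beta) hf
    ltac:(lra) ltac:(lra)) as h.
  rewrite (ln_f_alpha_beta_m1 alpha beta (n - beta)) in h by lra.
  replace (n - beta + beta) with n in h by ring.
  apply ln_le in hG; [|apply Gamma_pos; lra].
  replace (INR m) with (n - 1) in hfact by (unfold n; ring).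
  (* By [ln y <= y - 1] the difference is at most [beta / (n - beta)], and [n >= 2 * beta] gives the
     factor 2. *)
  assert (hq : ln n - ln (n - beta) <= 2 * beta / n).
  { rewrite <- ln_div by lra.
    pose proof (exp_ineq1_le (ln (n / (n - beta)))) as h1.
    rewrite exp_ln in h1 by (apply Rdiv_lt_0_compat; lra).
    apply Rle_trans with (n / (n - beta) - 1); [lra|].
    apply Rmult_le_reg_r with (n * (n - beta)); [nra|].
    replace ((n / (n - beta) - 1) * (n * (n - beta))) with (beta * n) by (field; lra).
    replace (2 * beta / n * (n * (n - beta))) with (2 * beta * (n - beta))
      by (field; lra).
    nra. }
  assert (hb2 : (n - alpha) * (ln n - ln (n - beta)) <= 2 * beta * (1 + Rabs alpha)).
  { apply Rle_trans with ((n - alpha) * (2 * beta / n));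
      [apply Rmult_le_compat_l; lra|].
    apply Rmult_le_reg_r with n; [lra|].
    replace ((n - alpha) * (2 * beta / n) * n) with (2 * beta * (n - alpha))
      by (field; lra).
    rewrite (Rmult_assoc (2 * beta)). apply Rmult_le_compat_l; [lra|].
    pose proof (Rle_abs (- alpha)) as h2. rewrite Rabs_Ropp in h2.
    pose proof (Rabs_pos alpha). nra. }
  lra.
Qed.

Lemma half_le_alpha (alpha beta : R) : 0 <= beta ->
  log_completely_monotonic 0 p_infty (f_alpha_beta_m1 alpha beta) ->
  1 / 2 <= alpha.
Proof.
  intros hb hf. apply Rnot_lt_le; intros ha.
  destruct (near_infinity_bound alpha beta hb ha hf) as [C hC].
  (* The exponential makes [(1/2 - alpha) * ln (n + 1)] exceed [C]; the rest meets the threshold on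
     [n]. *)
  destruct (INR_unbounded (2 * beta + 1 + exp (C / (1 / 2 - alpha)))) as [n hn].
  pose proof (exp_pos (C / (1 / 2 - alpha))) as he.
  specialize (hC n ltac:(lra)).
  assert (hlt : C / (1 / 2 - alpha) < ln (INR n + 1)).
  { rewrite <- (ln_exp (C / (1 / 2 - alpha))). apply ln_increasing; lra. }
  apply (Rmult_lt_compat_l (1 / 2 - alpha)) in hlt; [|lra].
  replace ((1 / 2 - alpha) * (C / (1 / 2 - alpha))) with C in hlt by (field; lra).
  lra.
Qed.

Theorem theorem1 (alpha beta : R) (hbeta : 0 <= beta)
  (hf : log_completely_monotonic 0 p_infty (f_alpha_beta_m1 alpha beta)) :
  (0 < beta /\ Rmax beta (1 / 2) <= alpha) \/ (beta = 0 /\ 1 <= alpha).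
Proof.
  destruct (near_zero_bound alpha beta hbeta hf) as [C hC].
  destruct hbeta as [hbeta | <-]; [left | right]; split; auto.
  - apply Rmax_lub; [|apply half_le_alpha with beta; auto; lra].
    enough (beta - alpha <= 0) by lra.
    (* For [x < 1], [ln (x + beta)] is at most [ln (1 + beta)] and goes into the constant. *)
    apply nonpos_of_mult_ln_bounded_below with (C - ln (1 + beta)).
    intros x hx. specialize (hC x hx).
    assert (ln (x + beta) <= ln (1 + beta)) by (apply ln_le; lra). lra.
  (* Here [ln (x + beta)] is [ln x], which raises the coefficient from [- alpha] to [1 - alpha]. *)
  - enough (1 - alpha <= 0) by lra.
    apply nonpos_of_mult_ln_bounded_below with C.
    intros x hx. specialize (hC x hx). rewrite Rplus_0_r in hC. lra.
Qed.
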